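(* Let $q=4f+1=x^2+4y^2$ be a prime power with $x,y\in\mathbb Z$ and $f$ odd. Let $C_0=D_0^4\cup D_1^4$, $C_1=D_0^4\cup D_2^4$ and $C_2=D_0^4\cup D_3^4$. Then $(\mathbb F_q,\operatorname{Dev}C_0\cup\operatorname{Dev}C_1\cup\operatorname{Dev}C_2)$ is a $2$-$(q,\frac{q-1}{2},\frac{3q-11}{4})$ adesign.
   Context: For a primitive element $\alpha$ of $\mathbb F_q$, the cyclotomic classes of order 4 are $D_0^4=\langle\alpha^4\rangle$ and $D_i^4=\alpha^iD_0^4$, $i=1,2,3$. $\operatorname{Dev}C=\{C+g\mid g\in\mathbb F_q\}$ (additive translates); the union of developments is taken as a collection of $3q$ blocks. A $t$-$(v,k,\lambda)$ adesign is an incidence structure with $v$ points and blocks of size $k$ such that every $t$-subset of points lies in exactly $\lambda$ or exactly $\lambda+1$ blocks, both values occurring. *)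

(* Defs.v *)
From mathcomp Require Import all_boot all_order all_algebra all_fingroup all_solvable.
Set Implicit Arguments.
Unset Strict Implicit.
Unset Printing Implicit Defensive.

Import GRing.Theory.
Local Open Scope ring_scope.

(* The class [D_i^N = alpha^i <alpha^N>], as a set of field elements; [alpha]
   is taken in the group of units so that [<[_]>] is the multiplicative cyclic
   subgroup ([<[_]>] in [F] itself would be additive). *)
Definition cyclotomic_class (F : finFieldType) (alpha : {unit F}) (N i : nat) :
    {set F} :=
  [set val alpha ^+ i * val u | u in <[alpha ^+ N]>%g].

Definition translate (V : finZmodType) (C : {set V}) (g : V) : {set V} :=
  [set c + g | c in C].

(* Collections of blocks are multisets, represented by sequences (whose order
   plays no role): [dev C] always has [#|V|] blocks, and the union of
   developments is concatenation, with repeated blocks kept. *)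
Definition dev (V : finZmodType) (C : {set V}) : seq {set V} :=
  [seq translate C g | g <- enum V].

Definition blocks_through (V : finType) (B : seq {set V}) (T : {set V}) : nat :=
  count (fun b : {set V} => T \subset b) B.

(* The point set is the whole type [V]. *)
Definition adesign (t v k lambda : nat) (V : finType) (B : seq {set V}) : Prop :=
  [/\ #|V| = v,
      forall b : {set V}, b \in B -> #|b| = k,
      forall T : {set V}, #|T| = t ->
        blocks_through B T = lambda \/ blocks_through B T = lambda.+1,
      exists T : {set V}, #|T| = t /\ blocks_through B T = lambda &
      exists T : {set V}, #|T| = t /\ blocks_through B T = lambda.+1].

(* Main.v *)
(** For q = 4f + 1 with f odd, the f-th power map sends D_i to the i-th power of
    w := alpha^f, a primitive fourth root of unity. For a block translate C_j + g,
    let i and i' be the classes of a - g and b - g (both nonzero); the number of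
    j in {0, 1, 2} with both differences in C_j is [i = 0] + [i' = 0] + [i = i'].
    Summing over g gives
    (f - [a - b in D_0]) + (f - [b - a in D_0]) + (f - 1), and a - b, b - a are
    not both in D_0 because (-1)^f = -1. *)
Require Import Defs.
From mathcomp Require Import all_boot all_order all_algebra all_fingroup all_solvable.
From mathcomp Require Import zify ring.
Set Implicit Arguments.
Unset Strict Implicit.
Unset Printing Implicit Defensive.

Import GRing.Theory.
Local Open Scope ring_scope.

(** * Translates and block counts as sums over shifts *)

Lemma mem_translate (V : finZmodType) (C : {set V}) (g z : V) :
  (z \in translate C g) = (z - g \in C).
Proof.
apply/imsetP/idP => [[c cC ->]|zC]; first by rewrite addrK.
by exists (z - g) => //; rewrite subrK.
Qed.

Lemma card_translate (V : finZmodType) (C : {set V}) (g : V) :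
  #|translate C g| = #|C|.
Proof. by rewrite card_imset //; apply: addIr. Qed.

Lemma blocks_through_cat (V : finType) (B1 B2 : seq {set V}) (T : {set V}) :
  blocks_through (B1 ++ B2) T = (blocks_through B1 T + blocks_through B2 T)%N.
Proof. exact: count_cat. Qed.

Lemma blocks_through_dev2 (V : finZmodType) (C : {set V}) (a b : V) :
  blocks_through (dev C) [set a; b] =
  (\sum_g ((a - g \in C)%R && (b - g \in C)%R))%N.
Proof.
rewrite /blocks_through /dev count_map -sum1_count big_enum_cond /= big_mkcond.
apply: eq_bigr => g _ /=.
by rewrite subUset !sub1set !mem_translate; case: (_ && _).
Qed.

Lemma card_set_sum (T : finType) (P : pred T) :
  #|[set g | P g]| = (\sum_g P g)%N.
Proof. by rewrite -sum1dep_card big_mkcond; apply: eq_bigr => g _; case: (P g). Qed.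

(** Used with [z] as 0, [wi] as the [i]-th power of [w], and [s], [t] as the [f]-th powers of
    [a - g] and [b - g]. [w0] lies in all three pairs and each other [wi] in one; the tests against
    [z] discard shifts where a difference vanishes. *)
Lemma pair_class_count (T : eqType) (z w0 w1 w2 w3 s t : T) :
  uniq [:: z; w0; w1; w2; w3] ->
  s \in [:: z; w0; w1; w2; w3] -> t \in [:: z; w0; w1; w2; w3] ->
  (((s == w0) || (s == w1)) && ((t == w0) || (t == w1)) +
   (((s == w0) || (s == w2)) && ((t == w0) || (t == w2)) +
    ((s == w0) || (s == w3)) && ((t == w0) || (t == w3))) =
   ((s == w0) && (t != z)) + ((t == w0) && (s != z)) +
   ((s == t) && (s != z)))%N.
Proof.
rewrite /= !inE !negb_or -!andbA.
case/and5P=> z0 z1 z2 z3 /and5P[n01 n02 n03 n12 /andP[n13 /andP[n23 _]]].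
(* [E] and [S] decide every equality test between distinct listed elements, in either
   orientation. *)
have E := (negPf z0, negPf z1, negPf z2, negPf z3, negPf n01, negPf n02,
  negPf n03, negPf n12, negPf n13, negPf n23).
have S := (eq_sym w0 z, eq_sym w1 z, eq_sym w2 z, eq_sym w3 z, eq_sym w1 w0,
  eq_sym w2 w0, eq_sym w3 w0, eq_sym w2 w1, eq_sym w3 w1, eq_sym w3 w2).
by case/or4P=> [||| /orP[]] /eqP->; case/or4P=> [||| /orP[]] /eqP->;
  rewrite ?S ?eqxx ?E.
Qed.

(** * Classes of order 4 detected by [f]-th powers *)

Section QuarticClasses.
Variables (F : finFieldType) (f : nat) (alpha : {unit F}).
Hypotheses (f_odd : odd f) (cardF : #|F| = (4 * f + 1)%N).
Hypothesis alpha_gen : generator [set: {unit F}] alpha.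

Let w : F := val alpha ^+ f.
Let f_gt0 : (0 < f)%N. Proof. by case: f f_odd. Qed.

Lemma order_alpha : #[alpha]%g = (4 * f)%N.
Proof.
by rewrite orderE -(eqP alpha_gen) card_finField_unit cardF addn1.
Qed.

Lemma val_expg (u : {unit F}) n : val (u ^+ n)%g = val u ^+ n.
Proof. exact: FinRing.val_unitX. Qed.

Lemma alpha_pow_eq m n :
  (val alpha ^+ m == val alpha ^+ n) = (m == n %[mod 4 * f])%N.
Proof.
by rewrite -!val_expg (inj_eq val_inj) eq_expg_mod_order order_alpha.
Qed.

Lemma log_alpha (z : F) : z != 0 -> exists n, z = val alpha ^+ n.
Proof.
rewrite -unitfE => zU.
have : FinRing.unit F zU \in <[alpha]>%g by rewrite -(eqP alpha_gen) inE.
by case/cycleP=> n E; exists n; rewrite -val_expg -E.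
Qed.

Lemma w_pow_eq m n : (w ^+ m == w ^+ n) = (m == n %[mod 4])%N.
Proof.
by rewrite -!exprM alpha_pow_eq ![(f * _)%N]mulnC -!muln_modl eqn_pmul2r.
Qed.

Lemma w_neq0 : w != 0.
Proof. by rewrite expf_neq0 // -unitfE; apply: valP. Qed.

Lemma uniq_w_pow : uniq [:: 0; w ^+ 0; w ^+ 1; w ^+ 2; w ^+ 3].
Proof.
by rewrite /= !inE !w_pow_eq !(eq_sym 0) !(negPf (expf_neq0 _ w_neq0)).
Qed.

Lemma pow_f_eq0 (z : F) : (z ^+ f == 0) = (z == 0).
Proof. by rewrite expf_eq0 f_gt0. Qed.

Lemma pow_f_mem (z : F) : z ^+ f \in [:: 0; w ^+ 0; w ^+ 1; w ^+ 2; w ^+ 3].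
Proof.
have [->|/log_alpha[n ->]] := eqVneq z 0; first by rewrite inE pow_f_eq0 eqxx.
rewrite exprAC -/w !inE.
by rewrite !w_pow_eq; apply/orP; right; have := ltn_pmod n (isT : 0 < 4)%N;
  case: (n %% 4)%N => [|[|[|[|]]]].
Qed.

(** The [f]-th power of [alpha ^+ n] is [w ^+ n], and [w] has order 4, so it records exactly the
    residue of [n] mod 4. *)
Lemma mem_cyclotomic_class (i : nat) (z : F) : (i < 4)%N ->
  (z \in cyclotomic_class alpha 4 i) = (z ^+ f == w ^+ i).
Proof.
move=> i4; apply/imsetP/eqP => [[u /cycleP[k ->] ->]|zf].
  apply/eqP; rewrite !val_expg -exprM -exprD -!exprM alpha_pow_eq.
  by rewrite -(modnMDl k (f * i) (4 * f)); apply/eqP; congr (_ %% _)%N; lia.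
have : z != 0 by rewrite -pow_f_eq0 zf expf_neq0 ?w_neq0.
case/log_alpha=> n zn; exists (alpha ^+ 4 ^+ (n %/ 4))%g; first exact: mem_cycle.
move/eqP: zf; rewrite zn exprAC -/w w_pow_eq (modn_small i4) => /eqP <-.
by rewrite !val_expg -exprM -exprD addnC mulnC -divn_eq.
Qed.

Lemma card_cyclotomic_class (i : nat) : #|cyclotomic_class alpha 4 i| = f.
Proof.
rewrite card_imset; last first.
  move=> u v /(mulfI _) E; apply/val_inj/E.
  by rewrite expf_neq0 // -unitfE; apply: valP.
by rewrite -orderE orderXdiv order_alpha ?dvdn_mulr // mulKn.
Qed.

Lemma card_class_union (i : nat) : (0 < i < 4)%N ->
  #|cyclotomic_class alpha 4 0 :|: cyclotomic_class alpha 4 i| = (2 * f)%N.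
Proof.
case/andP=> i0 i4; rewrite cardsU !card_cyclotomic_class.
suff -> : cyclotomic_class alpha 4 0 :&: cyclotomic_class alpha 4 i = set0.
  by rewrite cards0; lia.
apply/setP=> z; rewrite !inE !mem_cyclotomic_class //.
by apply/andP=> -[/eqP->]; rewrite w_pow_eq !modn_small // eq_sym; case: i i0 {i4}.
Qed.

(** * Counting shifts by the classes of the two differences *)

Lemma card_pow_f_eq1 : #|[set z : F | z ^+ f == 1]| = f.
Proof.
rewrite -[RHS](card_cyclotomic_class 0); apply: eq_card => z.
by rewrite mem_cyclotomic_class // inE expr0.
Qed.

(** The substitution [h = a - g] carries the shifts to the [f]-th roots of unity, and the excluded
    [g = b] to [h = a - b]. *)
Lemma card_class0_translate (a b : F) :
  (#|[set g | ((a - g)%R ^+ f == 1%R) && (b - g != 0)%R]|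
   + ((a - b)%R ^+ f == 1%R) = f)%N.
Proof.
rewrite -[RHS]card_pow_f_eq1 [RHS](cardsD1 (a - b)) inE addnC; congr (_ + _)%N.
have injB : injective (fun h : F => a - h).
  exact: inj_comp (@addrI _ a) oppr_inj.
rewrite -[RHS](card_imset _ injB); apply: eq_card => g; rewrite inE.
apply/andP/imsetP => [[ag bg]|[h]].
  exists (a - g); last by rewrite opprB subrKC.
  by rewrite !inE ag andbT (inj_eq injB) eq_sym -subr_eq0.
rewrite !inE => /andP[hab hf] ->; rewrite opprB subrKC hf; split=> //.
by apply: contraNneq hab => E; rewrite -subr_eq0 -E; apply/eqP; ring.
Qed.

(** The Möbius map sending [g] to [(a - g) / (b - g)] is a bijection onto the [f]-th roots of unity
    other than 1; the value 1 would force [a = b]. *)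
Lemma card_same_class (a b : F) : a != b ->
  #|[set g | ((a - g) ^+ f == (b - g) ^+ f) && (a - g != 0)]| = f.-1.
Proof.
move=> ab; set A := [set g | _].
have Ab g : g \in A -> b - g != 0.
  by rewrite inE -(pow_f_eq0 (a - g)) -(pow_f_eq0 (b - g)) => /andP[/eqP->].
have injh : {in A &, injective (fun g => (a - g) / (b - g))}.
  move=> g g' /Ab bg /Ab bg' /eqP; rewrite eqr_div // => /eqP E.
  have : (a - b) * (g - g') = (a - g) * (b - g') - (a - g') * (b - g) by ring.
  rewrite E subrr => /eqP; rewrite mulf_eq0 !subr_eq0 (negPf ab) /= => /eqP.
  exact.
rewrite -(card_in_imset injh) -[in RHS]card_pow_f_eq1.
rewrite [in RHS](cardsD1 1) [1 \in _]inE expr1n eqxx.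
apply: eq_card => z; rewrite !inE; apply/imsetP/andP => [[g gA ->]|[z1 /eqP zf]].
  have bg := Ab _ gA; move: gA; rewrite inE => /andP[/eqP E _]; split.
    by apply: contra ab => /eqP /divr1_eq /addIr ->.
  by rewrite expr_div_n E divff // pow_f_eq0.
have z10 : z - 1 != 0 by rewrite subr_eq0.
have ba : a - b != 0 by rewrite subr_eq0.
have z0 : z != 0 by rewrite -pow_f_eq0 zf oner_eq0.
(* The preimage of [z] solves [a - g = z * (b - g)] for [g]. *)
have eb : b - (z * b - a) / (z - 1) = (a - b) / (z - 1) by field.
have ea : a - (z * b - a) / (z - 1) = z * ((a - b) / (z - 1)) by field.
have nz : (a - b) / (z - 1) != 0 by rewrite mulf_neq0 ?invr_eq0.
exists ((z * b - a) / (z - 1)); last by rewrite ea eb mulfK.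
by rewrite inE ea eb exprMn zf mul1r eqxx mulf_neq0.
Qed.

(** The two indicators stand on the left to avoid truncated subtraction; the right side is
    [f + f + (f - 1)]. *)
Lemma blocks_through_pair (a b : F) : a != b ->
  let D := cyclotomic_class alpha 4 in
  (blocks_through (dev (D 0 :|: D 1) ++ dev (D 0 :|: D 2) ++ dev (D 0 :|: D 3))
     [set a; b]
   + ((a - b)%R ^+ f == 1%R) + ((b - a)%R ^+ f == 1%R) = 3 * f - 1)%N.
Proof.
move=> ab D; rewrite !blocks_through_cat !blocks_through_dev2.
suff -> : (\sum_g ((a - g \in D 0 :|: D 1)%R && (b - g \in D 0 :|: D 1)%R) +
    (\sum_g ((a - g \in D 0 :|: D 2)%R && (b - g \in D 0 :|: D 2)%R) +
     \sum_g ((a - g \in D 0 :|: D 3)%R && (b - g \in D 0 :|: D 3)%R)) =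
    #|[set g | ((a - g)%R ^+ f == 1%R) && (b - g != 0)%R]| +
    #|[set g | ((b - g)%R ^+ f == 1%R) && (a - g != 0)%R]| +
    #|[set g | ((a - g) ^+ f == (b - g) ^+ f)%R && (a - g != 0)%R]|)%N.
  rewrite card_same_class //.
  have := card_class0_translate a b; have := card_class0_translate b a.
  by move: f_gt0; lia.
rewrite !card_set_sum -!big_split; apply: eq_bigr => g _ /=.
have := pair_class_count uniq_w_pow (pow_f_mem (a - g)) (pow_f_mem (b - g)).
by rewrite !in_setU !mem_cyclotomic_class // expr0 !pow_f_eq0.
Qed.

Lemma w_sqr : w ^+ 2 = -1.
Proof.
have : (w ^+ 2 - 1) * (w ^+ 2 + 1) = 0.
  rewrite -subr_sqr_1 -exprM; apply/eqP; rewrite subr_eq0.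
  by rewrite -[X in _ == X](expr0 w) w_pow_eq.
move/eqP; rewrite mulf_eq0 subr_eq0 -[X in _ == X](expr0 w) w_pow_eq /=.
by rewrite addr_eq0 => /eqP.
Qed.

(** Since [f] is odd, -1 lies in class 2, so negation shifts the class index by 2. *)
Lemma pow_f_opp (z : F) : (- z) ^+ f = w ^+ 2 * z ^+ f.
Proof. by rewrite exprNn -signr_odd f_odd w_sqr. Qed.

End QuarticClasses.

Theorem theorem6 (p m q f : nat) (x y : int) (F : finFieldType)
    (alpha : {unit F})
    (p_prime : prime p) (m_gt0 : (0 < m)%N) (q_pp : q = (p ^ m)%N)
    (q_f : q = (4 * f + 1)%N) (q_xy : q%:Z = x ^+ 2 + 4 * y ^+ 2)
    (f_odd : odd f)
    (cardF : #|F| = q) (alpha_prim : generator [set: {unit F}] alpha) :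
  let D := cyclotomic_class alpha 4 in
  let C0 := D 0%N :|: D 1%N in
  let C1 := D 0%N :|: D 2%N in
  let C2 := D 0%N :|: D 3%N in
  adesign 2 q ((q - 1) %/ 2) ((3 * q - 11) %/ 4)
    (dev C0 ++ dev C1 ++ dev C2).
Proof.
move=> D C0 C1 C2; rewrite q_f in cardF *.
have [-> ->] : ((4 * f + 1 - 1) %/ 2 = 2 * f /\
    (3 * (4 * f + 1) - 11) %/ 4 = 3 * f - 2)%N by lia.
have f_gt0 : (0 < f)%N by case: (f) f_odd.
have w1 n : ((val alpha ^+ f) ^+ n == 1) = (n == 0 %[mod 4])%N.
  by rewrite -(w_pow_eq f_odd cardF alpha_prim) expr0.
have opp := pow_f_opp f_odd cardF alpha_prim.
(* [N] is abstract because the block counts in [blocks_through_pair] and in the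
   goal differ syntactically in their carrier structure, which defeats [lia]. *)
have cnt N a b : a != b ->
    N = blocks_through (dev C0 ++ dev C1 ++ dev C2) [set a; b] ->
    (N + ((a - b)%R ^+ f == 1%R) + ((b - a)%R ^+ f == 1%R) = 3 * f - 1)%N.
  by move=> ab ->; apply: (blocks_through_pair f_odd cardF alpha_prim ab).
split=> //.
- move=> b; rewrite !mem_cat => /or3P[] /mapP[g _ ->];
    by rewrite card_translate (card_class_union f_odd cardF alpha_prim).
- move=> T /eqP/cards2P[a [b [ab ->]]].
  set N := blocks_through _ _; have := cnt N a b ab erefl; rewrite -(opprB a b) opp.
  (* If [a - b] lies in class 0, then [b - a] lies in class 2, so at most one indicator is 1. *)
  case: eqP => [->|_]; last by case: (_ == 1) => /=; lia.
  by rewrite mulr1 w1 /=; lia.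
(* The difference 1 lies in class 0, so one indicator is 1 and the count is [3 * f - 2]. *)
- exists [set 1; 0]; rewrite cards2 oner_eq0; split=> //.
  set N := blocks_through _ _; have := cnt N 1 0 (oner_neq0 F) erefl; rewrite sub0r opp subr0.
  by rewrite expr1n mulr1 eqxx w1 /=; lia.
(* The differences [alpha] and its opposite lie in classes 1 and 3, so both indicators vanish and
   the count is [3 * f - 1]. *)
- have a0 : val alpha != 0 by rewrite -unitfE; apply: valP.
  exists [set val alpha; 0]; rewrite cards2 a0; split=> //.
  set N := blocks_through _ _; have := cnt N _ _ a0 erefl; rewrite sub0r opp subr0.
  by rewrite -exprSr (w1 3) -[_ ^+ f]expr1 w1 /=; lia.
Qed.
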